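(* There exists a planar signed simple graph $(G,\sigma)$ whose fractional balanced chromatic number satisfies $\chi_{fb}(G,\sigma) > 2$.
   Context: A signed graph $(G,\sigma)$ is a graph $G$ together with a signature $\sigma: E(G)\to\{+,-\}$. A cycle is negative if it has an odd number of negative edges. A set of vertices is balanced if the subgraph it induces contains no negative cycle. For positive integers $p,q$, a balanced $(p,q)$-coloring of $(G,\sigma)$ is an assignment to each vertex of a set of $q$ colors from $\{1,\dots,p\}$ such that, for each color, the set of vertices receiving that color is balanced. The fractional balanced chromatic number $\chi_{fb}(G,\sigma)$ is the minimum of $p/q$ over all pairs $(p,q)$ for which a balanced $(p,q)$-coloring exists. A simple graph has no loops and no parallel edges. *)

(* Defs.v *)
From HB Require Import structures.
From mathcomp Require Import all_boot all_order all_algebra.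
From mathcomp Require Import all_classical all_reals all_analysis.
Set Implicit Arguments.
Unset Strict Implicit.
Unset Printing Implicit Defensive.
Import Order.TTheory GRing.Theory Num.Theory.
Import numFieldNormedType.Exports.

Local Open Scope classical_set_scope.
Local Open Scope ring_scope.

(* The value of [neg] on non-adjacent pairs is irrelevant: every use below
   evaluates it on edges only. *)
Record signed_graph := SignedGraph {
  vertex :> finType;
  adj : rel vertex;
  adj_sym : symmetric adj;
  adj_irr : irreflexive adj;
  neg : rel vertex;
  neg_sym : symmetric neg }.

Section Balanced.
Variable G : signed_graph.

(* As [c] is duplicate-free, the edges of the cycle are the pairs
   {x, next c x} with x in c, each counted once since 2 < size c. *)
Definition graph_cycle (c : seq G) : Prop :=
  ucycle (@adj G) c /\ (2 < size c)%N.

Definition negative_cycle (c : seq G) : Prop :=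
  graph_cycle c /\ odd (count (fun x => neg x (next c x)) c).

Definition balanced (A : {set G}) : Prop :=
  forall c : seq G, {subset c <= A} -> ~ negative_cycle c.

Definition balanced_coloring (p q : nat) (f : G -> {set 'I_p}) : Prop :=
  (forall v, #|f v| = q) /\
  (forall i : 'I_p, balanced [set v | i \in f v]%SET).

Definition balanced_colorable (p q : nat) : Prop :=
  [/\ (0 < p)%N, (0 < q)%N & exists f : G -> {set 'I_p},
    balanced_coloring q f].

End Balanced.

Section FractionalBalanced.
Variables (R : realType) (G : signed_graph).

Definition balanced_ratios : set R :=
  [set r | exists p q : nat, balanced_colorable G p q /\ r = p%:R / q%:R].

(* The minimum is expressed as the infimum, a total operation; the two agree by
   chi_fb_min. The ratios are bounded below by 0, and the set is nonempty as
   giving each vertex its own color is a balanced coloring. *)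
Definition chi_fb : R := inf balanced_ratios.

Lemma chi_fb_min (m : R) :
  balanced_ratios m -> lbound balanced_ratios m -> chi_fb = m.
Proof.
move=> Sm lbm; apply/eqP; rewrite eq_le; apply/andP; split.
  by apply: ge_inf => //; exists m.
by apply: lb_le_inf => //; exists m.
Qed.

End FractionalBalanced.

Section Planar.
Variable R : realType.

Definition is_arc (a b : R * R) (A : set (R * R)) : Prop :=
  exists g : R -> R * R,
    [/\ {within `[0, 1], continuous g},
        {in `[0, 1] &, injective g},
        g 0 = a, g 1 = b & A = g @` `[0, 1]].

Variable G : signed_graph.

(* Edges are drawn as simple arcs; [arc x y] is the point set drawing the edge
   xy, independent of its orientation. An arc meets vertices only at its ends,
   and two distinct edges meet only at the images of common end-vertices. *)
Definition plane_drawing (pt : G -> R * R) (arc : G -> G -> set (R * R)) :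
    Prop :=
  [/\ injective pt,
      forall x y, adj x y -> is_arc (pt x) (pt y) (arc x y),
      forall x y, adj x y -> arc x y = arc y x,
      forall x y z, adj x y -> arc x y (pt z) -> z = x \/ z = y &
      forall x y x' y', adj x y -> adj x' y' ->
        (x', y') <> (x, y) -> (x', y') <> (y, x) ->
        arc x y `&` arc x' y' `<=` pt @` ([set x; y] `&` [set x'; y'])].

Definition planar : Prop := exists pt arc, plane_drawing pt arc.

End Planar.

(* Main.v *)
Require Import Defs.
From HB Require Import structures.
From Stdlib Require Import ZArith.
From mathcomp Require Import all_boot all_order all_algebra.
From mathcomp Require Import all_classical all_reals all_analysis.
From mathcomp Require Import ssrZ ring lra zify.
Set Implicit Arguments.
Unset Strict Implicit.
Unset Printing Implicit Defensive.
Import Order.TTheory GRing.Theory Num.Theory.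
Import numFieldNormedType.Exports.
Local Open Scope ring_scope.

(** In a K4 all of whose triangles are negative, a balanced set has at most two
    vertices, and at most one if it misses one of the triangles.  So in a
    coloring of ratio 2 every color class meets every triangle that is filled in
    this way.  There is a planar signed graph on 24 vertices with eight filled
    triangles and an edge {0, 1}, such that no balanced set containing both 0
    and 1 meets all eight triangles: the edge behaves like a pair of parallel
    edges of opposite signs.  Put one copy of this gadget on each side of a
    triangle.  A color class of a coloring of ratio 2 would then contain at most
    one of the three corners, which is too few on average.  Quantitatively, give
    every vertex twice the number of K4's containing it, plus 1 at each corner:
    the total weight is 195, but balanced sets have weight at most 97. *)

(** * Lower bounds on the fractional balanced chromatic number by weighting vertices *)

Section FractionalBound.
Variable G : signed_graph.
Implicit Types (A : {set G}) (L : seq G).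

Lemma balanced_set1 (v : G) : balanced [set v]%SET.
Proof.
move=> c sub_c [[/andP[_ Uc] sz] _].
have : (size c <= size [:: v])%N.
  by apply: uniq_leq_size => // u /sub_c; rewrite !inE.
by rewrite leqNgt (leq_trans _ sz).
Qed.

Lemma balanced_colorable_rank : (0 < #|G|)%N -> balanced_colorable G #|G| 1.
Proof.
move=> G0; split=> //; exists (fun v => [set enum_rank v]%SET); split.
  by move=> v; rewrite cards1.
move=> i.
suff -> : [set v | i \in [set enum_rank v]]%SET = [set enum_val i]%SET.
  exact: balanced_set1.
by apply/setP => v; rewrite !inE eq_sym (can2_eq enum_rankK enum_valK).
Qed.

(** Double counting of the pairs of an entry of [L] and a color that it receives. Repetitions in [L]
    serve as integer weights. *)
Lemma balanced_colorable_count L m p q :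
    (forall A, balanced A -> count [in A] L <= m)%N ->
  balanced_colorable G p q -> (size L * q <= m * p)%N.
Proof.
move=> Lm [_ _ [f [fq fb]]].
have -> : (size L * q = \sum_(v <- L) #|f v|)%N.
  rewrite (eq_bigr (fun=> q)) => [|v _]; last exact: fq.
  by rewrite big_const_seq count_predT iter_addn_0 mulnC.
have -> : (\sum_(v <- L) #|f v| =
           \sum_(i < p) count [in [set v | i \in f v]%SET] L)%N.
  rewrite (eq_bigr (fun v => \sum_(i < p) (i \in f v : nat)))%N; last first.
    by move=> v _; rewrite -sum1_card big_mkcond.
  rewrite exchange_big /=; apply: eq_bigr => i _.
  rewrite -sum1_count [RHS]big_mkcond /=.
  by apply: eq_bigr => v _; rewrite inE; case: (i \in f v).
rewrite -[p in (_ * p)%N]card_ord mulnC -sum_nat_const.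
by apply: leq_sum => i _; exact: Lm.
Qed.

Lemma chi_fb_ge (R : realType) L m :
    (0 < size L)%N -> (forall A, balanced A -> count [in A] L <= m)%N ->
  (size L)%:R / m%:R <= chi_fb R G.
Proof.
move=> L0 Lm; apply: lb_le_inf.
  exists (#|G|%:R / 1%:R), #|G|, 1%N; split=> //.
  apply: balanced_colorable_rank.
  by case: L L0 {Lm} => // v L _; apply/card_gt0P; exists v.
move=> r [p [q [pq ->]]].
have := balanced_colorable_count Lm pq; case: pq => p0 q0 _ le_pq.
(* For [m = 0] the quotient is 0, as the inverse of 0 is 0. *)
have [->|m0] := posnP m; first by rewrite invr0 mulr0 divr_ge0.
rewrite ler_pdivrMr ?ltr0n // mulrAC ler_pdivlMr ?ltr0n //.
by rewrite -!natrM ler_nat [(p * m)%N]mulnC.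
Qed.

End FractionalBound.

(** * Signed graphs given by relations on numbers, with cycle tests that compute *)

Section OrdinalGraph.
Variables (n : nat) (E : rel nat) (S : rel nat).
Hypotheses (E_sym : symmetric E) (E_irr : irreflexive E) (S_sym : symmetric S).

Definition ord_graph : signed_graph :=
  @SignedGraph 'I_n (fun i j => E i j) (fun i j => E_sym i j)
    (fun i => E_irr i) (fun i j => S i j) (fun i j => S_sym i j).

(** The value [false] out of range matches the entries that [pmap insub] drops. *)
Definition mem_val (A : {set ord_graph}) (i : nat) : bool :=
  if insub i is Some v then v \in A else false.

Definition is_negative_cycle (c : seq nat) : bool :=
  [&& all (gtn n) c, cycle E c, uniq c, (2 < size c)%N &
      odd (count (fun i => S i (next c i)) c)].

Lemma balanced_negative_cycle (A : {set ord_graph}) (c : seq nat) :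
  balanced A -> is_negative_cycle c -> ~~ all (mem_val A) c.
Proof.
move=> bA /and5P[c_n Ec Uc sz odd_c]; apply/negP => cA.
pose d : seq ord_graph := pmap insub c.
have dE : map val d = c.
  rewrite /d (pmap_filter (insubK _)); apply/all_filterP/allP => i ic.
  by rewrite isSome_insub; exact: (allP c_n).
have Ud : uniq d by apply: (@map_uniq _ _ val); rewrite dE.
apply: (bA d) => [v vd|].
  have := allP cA (val v); rewrite -dE mem_map; last exact: val_inj.
  by rewrite /mem_val valK => /(_ vd).
split; first split.
- rewrite /ucycle /ucycleb Ud andbT.
  by move: Ec; rewrite -dE cycle_map.
- by move: sz; rewrite -dE size_map.
move: odd_c; rewrite -dE count_map.
congr odd; apply: eq_count => v /=.
by rewrite next_map //; exact: val_inj.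
Qed.

Lemma count_mem_val (A : {set ord_graph}) (s : seq nat) :
  count [in A] (pmap insub s) = count (mem_val A) s.
Proof.
elim: s => //= i s <-; rewrite /mem_val.
by case: insub.
Qed.

End OrdinalGraph.

(** * Crossing tests for segments, from orientation determinants *)

Definition orient (K : pzRingType) (a b c : K * K) : K :=
  (b.1 - a.1) * (c.2 - a.2) - (b.2 - a.2) * (c.1 - a.1).

(* Nested conditionals rather than disjunctions, so that call-by-value
   evaluation stops at the first test that succeeds. *)
Definition separated (K : numDomainType) (a b c d : K * K) : bool :=
  if 0 < orient a b c * orient a b d then true
  else if 0 < orient c d a * orient c d b then true
  else if (c == a) || (c == b) then orient a b d != 0
  else ((d == a) || (d == b)) && (orient a b c != 0).

Section Segments.
Variable R : realType.
Implicit Types a b c d p : R * R.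

Definition affine a b (t : R) : R * R :=
  (a.1 + t * (b.1 - a.1), a.2 + t * (b.2 - a.2)).

Definition segment a b : set (R * R) :=
  (affine a b @` `[0, 1])%classic.

Lemma affine_continuous a b : continuous (affine a b).
Proof.
move=> t; apply: (@cvg_pair _ _ _ _ (nbhs (a.1 + t * (b.1 - a.1)))
                                    (nbhs (a.2 + t * (b.2 - a.2)))).
  by apply: cvgD; [exact: cvg_cst|apply: cvgMr_tmp].
by apply: cvgD; [exact: cvg_cst|apply: cvgMr_tmp].
Qed.

Lemma affine_inj a b : a != b -> injective (affine a b).
Proof.
move=> ab s t [/addrI e1 /addrI e2]; apply/eqP; apply: contraNT ab => st.
have cancel_st x : s * x = t * x -> x = 0.
  move=> /eqP; rewrite -subr_eq0 -mulrBl mulf_eq0 subr_eq0 (negbTE st).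
  by move/eqP.
case: a b e1 e2 => [a1 a2] [b1 b2] /=.
by move=> /cancel_st/subr0_eq-> /cancel_st/subr0_eq->; exact: eqxx.
Qed.

Lemma affine0 a b : affine a b 0 = a.
Proof. by rewrite /affine !mul0r !addr0 -surjective_pairing. Qed.

Lemma affine1 a b : affine a b 1 = b.
Proof.
by rewrite /affine !mul1r addrC subrK addrC subrK -surjective_pairing.
Qed.

Lemma affine_rev a b t : affine b a t = affine a b (1 - t).
Proof. by rewrite /affine; congr (_, _); ring. Qed.

Lemma segmentC a b : segment a b = segment b a.
Proof.
suff sub x y : (segment x y `<=` segment y x)%classic.
  by apply/seteqP; split; exact: sub.
move=> _ [t t01 <-]; exists (1 - t); last by rewrite affine_rev subKr.
by move: t01; rewrite /= !in_itv /= => /andP[? ?]; apply/andP; split; lra.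
Qed.

Lemma segment_is_arc a b : a != b -> is_arc a b (segment a b).
Proof.
move=> ab; exists (affine a b); split=> //.
- exact/continuous_subspaceT/affine_continuous.
- by move=> s t _ _; exact: affine_inj.
- exact: affine0.
- exact: affine1.
Qed.

Lemma orient_affine a b c d t :
  orient a b (affine c d t) = (1 - t) * orient a b c + t * orient a b d.
Proof. by rewrite /orient /=; ring. Qed.

Lemma orient_segment a b p : segment a b p -> orient a b p = 0.
Proof. by move=> [t _ <-]; rewrite /orient /=; ring. Qed.

Lemma segments_disjoint a b c d p : 0 < orient a b c * orient a b d ->
  segment a b p -> ~ segment c d p.
Proof.
move=> cd_same /orient_segment abp [t].
rewrite /= in_itv /= => /andP[t0 t1] pE; move: abp; rewrite -pE orient_affine.
move: (orient a b c) (orient a b d) cd_same => x y xy e.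
(* Multiplying the convex combination by [x + y] leaves nonnegative squares plus [x * y > 0], so it
   cannot vanish. *)
have : 0 < (1 - t) * x ^+ 2 + t * y ^+ 2 + x * y.
  by rewrite ltr_wpDl // addr_ge0 // mulr_ge0 ?sqr_ge0 // subr_ge0.
suff -> : (1 - t) * x ^+ 2 + t * y ^+ 2 + x * y =
          ((1 - t) * x + t * y) * (x + y) by rewrite e mul0r ltxx.
by ring.
Qed.

Lemma segments_meet_at a b c d p : orient a b c = 0 -> orient a b d != 0 ->
  segment a b p -> segment c d p -> p = c.
Proof.
move=> abc abd /orient_segment abp [t _ pE]; move: abp; rewrite -pE.
rewrite orient_affine abc mulr0 add0r => /eqP.
by rewrite mulf_eq0 (negbTE abd) orbF => /eqP->; exact: affine0.
Qed.

Lemma orient_endpoint a b c : (c == a) || (c == b) -> orient a b c = 0.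
Proof. by case/orP => /eqP->; rewrite /orient; ring. Qed.

(** Two ends strictly on one side of the other line exclude a common point. Otherwise one end is
    shared and the other end of [c d] is off the line [a b], which [c d] then meets only once. *)
Lemma separatedP a b c d p : separated a b c d ->
  segment a b p -> segment c d p ->
  p = c /\ ((c == a) || (c == b)) \/ p = d /\ ((d == a) || (d == b)).
Proof.
rewrite /separated => sep pab pcd; move: sep.
case: ifP => [same _|_]; first by case: (segments_disjoint same pab).
case: ifP => [same _|_]; first by case: (segments_disjoint same pcd).
case: ifP => [cab abd|_ /andP[dab abc]].
  by left; split=> //; apply: segments_meet_at pab pcd => //;
    exact: orient_endpoint.
right; split=> //; rewrite segmentC in pcd.
by apply: segments_meet_at pab pcd => //; exact: orient_endpoint.
Qed.

(** Binary integer coordinates let the crossing tests be evaluated, then transferred to the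
    reals. *)
Definition of_Z (z : Z) : R := (int_of_Z z)%:~R.

Definition point_of_Z (a : Z * Z) : R * R := (of_Z a.1, of_Z a.2).

Lemma of_ZB : {morph of_Z : x y / x - y}.
Proof. by move=> x y; rewrite /of_Z !rmorphB. Qed.

Lemma of_ZM : {morph of_Z : x y / x * y}.
Proof. by move=> x y; rewrite /of_Z !rmorphM. Qed.

Lemma of_Z_inj : injective of_Z.
Proof. by move=> x y /intr_inj; exact: (can_inj int_of_ZK). Qed.

Lemma of_Z_gt0 z : 0 < z -> 0 < of_Z z.
Proof. by rewrite /of_Z ltr0z; case: z => // p _; lia. Qed.

Lemma of_Z_neq0 z : z != 0 -> of_Z z != 0.
Proof. by apply: contraNneq => z0; apply/eqP/of_Z_inj; rewrite z0. Qed.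

Lemma point_of_Z_inj : injective point_of_Z.
Proof. by move=> [a b] [c d] [/of_Z_inj-> /of_Z_inj->]. Qed.

Lemma orient_of_Z (a b c : Z * Z) :
  orient (point_of_Z a) (point_of_Z b) (point_of_Z c) = of_Z (orient a b c).
Proof. by rewrite /orient of_ZB !of_ZM !of_ZB. Qed.

Lemma separated_of_Z (a b c d : Z * Z) : separated a b c d ->
  separated (point_of_Z a) (point_of_Z b) (point_of_Z c) (point_of_Z d).
Proof.
rewrite /separated !orient_of_Z -!of_ZM !(inj_eq point_of_Z_inj).
case: ifP => [/of_Z_gt0->//|_]; case: ifP => [/of_Z_gt0->|_].
  by rewrite if_same.
by case: ifP => [_ /of_Z_neq0->|_ /andP[-> /of_Z_neq0->]]; rewrite !if_same.
Qed.

End Segments.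

(** * Planarity of a straight-line drawing from finite checks *)

Section PlaneGraph.
Variables (n : nat) (edges : seq (nat * nat)) (S : rel nat).
Hypothesis S_sym : symmetric S.

Definition edge_rel (i j : nat) : bool :=
  ((i, j) \in edges) || ((j, i) \in edges).

Lemma edge_rel_sym : symmetric edge_rel.
Proof. by move=> i j; rewrite /edge_rel orbC. Qed.

Hypothesis edges_irr : all (fun e => e.1 != e.2) edges.

Lemma edge_rel_irr : irreflexive edge_rel.
Proof.
move=> i; rewrite /edge_rel orbb; apply/negP => /(allP edges_irr) /=.
by rewrite eqxx.
Qed.

Definition edge_graph : signed_graph :=
  ord_graph n edge_rel_sym edge_rel_irr S_sym.

Variable points : seq (Z * Z).

Definition edge_segments : seq ((nat * nat) * ((Z * Z) * (Z * Z))) :=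
  [seq (e, (nth (0, 0) points e.1, nth (0, 0) points e.2)) | e <- edges].

Definition edges_separated : bool :=
  let segs := edge_segments in
  all (fun s => all (fun s' =>
    if separated s.2.1 s.2.2 s'.2.1 s'.2.2 then true else s.1 == s'.1)
    segs) segs.

Variable R : realType.
Hypotheses (size_points : size points = n) (uniq_points : uniq points).
Hypothesis edges_cover :
  all (fun i => has (fun e => (e.1 == i) || (e.2 == i)) edges) (iota 0 n).
Hypothesis edges_bounded : all (fun e => (e.1 < n)%N && (e.2 < n)%N) edges.
Hypothesis separated_edges : edges_separated.

Let pt (v : edge_graph) : R * R := point_of_Z R (nth (0, 0) points (val v)).

Let pt_inj : injective pt.
Proof.
move=> u v /point_of_Z_inj /eqP.
by rewrite nth_uniq ?size_points ?ltn_ord // => /eqP /val_inj.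
Qed.

Let edgeP (x y : edge_graph) : adj x y ->
  exists u v : edge_graph, [/\ (val u, val v) \in edges,
    segment (pt x) (pt y) = segment (pt u) (pt v) &
    (u, v) = (x, y) \/ (u, v) = (y, x)].
Proof.
case/orP => xy; first by exists x, y; split=> //; left.
by exists y, x; split=> //; [exact: segmentC|right].
Qed.

Let segments_sep (e e' : nat * nat) : e \in edges -> e' \in edges -> e != e' ->
  separated (nth (0, 0) points e.1) (nth (0, 0) points e.2)
            (nth (0, 0) points e'.1) (nth (0, 0) points e'.2).
Proof.
move=> ee ee' /negbTE ne.
have := allP separated_edges _ (map_f _ ee) => /allP /(_ _ (map_f _ ee')) /=.
by rewrite ne; case: separated.
Qed.

Let crossing (x y x' y' : edge_graph) : adj x y -> adj x' y' ->
    (x', y') <> (x, y) -> (x', y') <> (y, x) ->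
  (segment (pt x) (pt y) `&` segment (pt x') (pt y') `<=`
   pt @` ([set x; y] `&` [set x'; y']))%classic.
Proof.
move=> /edgeP[u [v [uv -> uvE]]] /edgeP[u' [v' [uv' -> uvE']]] ne1 ne2.
(* Equal listed pairs would make the two edges equal up to reversal. *)
have ne : (val u, val v) != (val u', val v').
  apply/eqP => -[/val_inj euu' /val_inj evv']; subst u' v'.
  case: uvE uvE' => -[-> ->] [] [ex ey];
    [apply: ne1|apply: ne2|apply: ne2|apply: ne1]; by rewrite ex ey.
have setE : ([set x; y] `&` [set x'; y'] = [set u; v] `&` [set u'; v'])%classic.
  case: uvE uvE' => -[-> ->] [] [-> ->] //.
  - by rewrite (setUC [set y']%classic).
  - by rewrite (setUC [set y]%classic).
  - by rewrite (setUC [set y]%classic) (setUC [set y']%classic).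
rewrite setE => p [/= puv puv'].
have := separatedP (separated_of_Z R (segments_sep uv uv' ne)) puv puv'.
case=> -[-> /orP[]/eqP/pt_inj e].
- by exists u' => //; split; left.
- by exists u' => //; split; [right|left].
- by exists v' => //; split; [left|right].
- by exists v' => //; split; right.
Qed.

Let neighbour (z : edge_graph) : exists z', adj z z'.
Proof.
have /hasP[[i j] ij zij] := allP edges_cover (val z)
  ltac:(by rewrite mem_iota /=).
have /andP[/= ltin ltjn] := allP edges_bounded _ ij.
case/orP: zij => /= /eqP zE.
  by exists (Ordinal ltjn); rewrite /= /edge_rel -zE ij.
by exists (Ordinal ltin); rewrite /= /edge_rel -zE ij orbT.
Qed.

Lemma edge_graph_planar : planar R edge_graph.
Proof.
exists pt, (fun x y => segment (pt x) (pt y)); split.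
- exact: pt_inj.
- move=> x y xy; apply: segment_is_arc; rewrite (inj_eq pt_inj).
  by apply: contraTneq xy => ->; rewrite adj_irr.
- by move=> x y _; exact: segmentC.
- (* A vertex on an edge lies where this edge meets an edge at that vertex. *)
  move=> x y z xy pz.
  have [z' zz'] := neighbour z.
  have zz : segment (pt z) (pt z') (pt z).
    by exists 0; [rewrite /= in_itv /= lexx ler01|exact: affine0].
  have [[-> _]|ne1] := pselect ((z, z') = (x, y)); first by left.
  have [[-> _]|ne2] := pselect ((z, z') = (y, x)); first by right.
  have [w [wxy _] /pt_inj <-] := crossing xy zz' ne1 ne2 (conj pz zz).
  exact: wxy.
- exact: crossing.
Qed.

End PlaneGraph.

(** * The gadget and its bound *)

Section Gadget.
Local Open Scope nat_scope.

Definition gadget_edges : seq (nat * nat) :=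
  [:: (0, 1); (0, 2); (0, 3); (0, 4); (0, 5); (1, 2); (1, 4); (1, 6); (1, 7);
      (1, 8); (1, 9); (1, 10); (2, 5); (2, 8); (2, 16); (3, 4); (3, 5);
      (3, 7); (3, 11); (3, 12); (3, 13); (3, 17); (3, 18); (3, 19); (4, 7);
      (4, 17); (5, 8); (5, 11); (5, 12); (5, 14); (5, 16); (5, 18); (5, 20);
      (6, 7); (6, 8); (6, 10); (6, 11); (6, 15); (6, 21); (6, 22); (7, 11);
      (7, 17); (7, 21); (8, 9); (8, 11); (8, 15); (8, 16); (8, 22); (9, 10);
      (9, 15); (9, 23); (10, 15); (10, 23); (11, 13); (11, 14); (11, 19);
      (11, 20); (11, 21); (11, 22); (12, 13); (12, 14); (12, 18); (13, 14);
      (13, 19); (14, 20); (15, 23)].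

(** All other edges are negative. Among the filled K4s only 18, 3, 5, 12 has positive edges: the
    star at 3, so its triangles stay negative. *)
Definition gadget_positive : seq (nat * nat) :=
  [:: (0, 5); (1, 6); (1, 7); (1, 9); (1, 10); (3, 5); (3, 12); (3, 18);
      (8, 9)].

(* Each quadruple spans a K4 all of whose triangles are negative; its head is a
   vertex of degree 3 placed in the triangular face formed by the others. *)
Definition gadget_K4 : seq (seq nat) :=
  [:: [:: 16; 2; 5; 8]; [:: 17; 3; 4; 7]; [:: 18; 3; 5; 12];
      [:: 19; 3; 11; 13]; [:: 20; 5; 11; 14]; [:: 21; 6; 7; 11];
      [:: 22; 6; 8; 11]; [:: 23; 9; 10; 15]].

Definition triangles (s : seq nat) : seq (seq nat) :=
  if s is [:: a; b; c; d] then
    [:: [:: a; b; c]; [:: a; b; d]; [:: a; c; d]; [:: b; c; d]] else [::].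

Definition gadget_cycles : seq (seq nat) :=
  [:: [:: 0; 1; 2]; [:: 0; 1; 4]; [:: 0; 3; 5]; [:: 1; 8; 9]; [:: 6; 1; 7];
      [:: 0; 1; 7; 11; 5]; [:: 12; 13; 14]; [:: 0; 1; 7; 3]; [:: 0; 1; 8; 5];
      [:: 1; 7; 11; 8]; [:: 0; 1; 8; 11; 3]; [:: 6; 1; 10]; [:: 6; 8; 15]].

Definition gadget_negative_cycles : seq (seq nat) :=
  gadget_cycles ++ flatten [seq triangles s | s <- gadget_K4].

Lemma count_K4 (b : pred nat) (s : seq nat) :
    size s == 4 -> all (fun c => ~~ all b c) (triangles s) ->
  count b s <= (has b (behead s)).+1.
Proof.
case: s => [|x [|y [|z [|t []]]]] //= _.
by case: (b x); case: (b y); case: (b z); case: (b t).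
Qed.

(** If 0 and 1 are chosen, 2 and 4 are not, so exactly one of 5, 8 and exactly one of 3, 7 are, but
    not 3 with 5. Choosing 5, 7 leaves 6, 8, 11 unmet; 7, 8 forces the triangle 12, 13, 14; 3, 8
    forces 6 and leaves 9, 10, 15 unmet. *)
Lemma gadget_terminals (b : pred nat) :
    all (fun c => ~~ all b c) gadget_cycles ->
    all (fun s => has b (behead s)) gadget_K4 ->
  ~~ (b 0 && b 1).
Proof.
rewrite /=; case: (b 0) => //=; case: (b 1) => //=.
case: (b 2) => //=; case: (b 4) => //=; case: (b 7) => //=; case: (b 8) => //=;
case: (b 3) => //=; case: (b 5) => //=; case: (b 11) => //=;
case: (b 6) => //=; case: (b 9) => //=; case: (b 10) => //=;
case: (b 15) => //=; case: (b 12) => //=; case: (b 13) => //=;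
by case: (b 14).
Qed.

(** Each of the eight K4s contributes at most 2; if 0 and 1 are both chosen, some filled triangle is
    missed and the unit saved there pays for the extra term. *)
Lemma count_gadget (b : pred nat) :
    all (fun c => ~~ all b c) gadget_negative_cycles ->
  count b (flatten gadget_K4) + (b 0 && b 1) <= 16.
Proof.
rewrite /gadget_negative_cycles all_cat => /andP[bc /allP bT].
have bK s : s \in gadget_K4 -> all (fun c => ~~ all b c) (triangles s).
  by move=> sK; apply/allP => c cs; apply: bT; apply/flatten_mapP; exists s.
pose h := fun s : seq nat => has b (behead s).
have le_h (K : seq (seq nat)) : {subset K <= gadget_K4} ->
    count b (flatten K) <= size K + count h K.
  elim: K => //= s K IH sK; rewrite count_cat.
  have sK4 : s \in gadget_K4 by apply: sK; rewrite mem_head.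
  have s4 : size s == 4 by move: s {sK} sK4; apply/allP.
  have := count_K4 s4 (bK s sK4).
  have := IH (fun t tK => sK t (mem_behead (s := s :: K) tK)).
  by rewrite -/(h s); lia.
have := le_h gadget_K4 (fun _ => id).
have := count_size h gadget_K4; have := all_count h gadget_K4.
have [/(gadget_terminals bc)/negbTE-> _|_ /esym/negbT] := boolP (all h _).
  by rewrite [size _]/=; lia.
by move: (b 0 && b 1) => b01; rewrite [size _]/=; lia.
Qed.

End Gadget.

(** * Three gadgets on a triangle: 3 + 3 * 22 = 69 vertices *)

Section Example.
Local Open Scope nat_scope.

(* The corners are 0, 1, 2; copy k has its vertices 0 and 1 at the corners k and
   k + 1 mod 3, and its remaining 22 vertices in a block of their own. *)
Definition place (k j : nat) : nat :=
  if j == 0 then k else if j == 1 then k.+1 %% 3 else 22 * k + j.+1.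

Definition place_pairs (s : seq (nat * nat)) : seq (nat * nat) :=
  flatten [seq [seq (place k e.1, place k e.2) | e <- s] | k <- iota 0 3].

Definition example_edges := place_pairs gadget_edges.

Definition example_negative (i j : nat) : bool :=
  ~~ (((i, j) \in place_pairs gadget_positive) ||
      ((j, i) \in place_pairs gadget_positive)).

Lemma example_negative_sym : symmetric example_negative.
Proof. by move=> i j; rewrite /example_negative orbC. Qed.

Lemma example_irr : all (fun e => e.1 != e.2) example_edges.
Proof. by vm_compute. Qed.

Definition example : signed_graph :=
  edge_graph 69 example_negative_sym example_irr.

Lemma place_negative_cycles k : k < 3 ->
  all (fun c => is_negative_cycle 69 (edge_rel example_edges) example_negative
                  (map (place k) c)) gadget_negative_cycles.
Proof.
have : all (fun k => all (fun c => is_negative_cycle 69 (edge_rel example_edges)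
    example_negative (map (place k) c)) gadget_negative_cycles) (iota 0 3).
  by vm_compute.
by move=> /allP + k3; apply; rewrite mem_iota.
Qed.

Definition placed_K4 (k : nat) : seq nat := map (place k) (flatten gadget_K4).

(** Weights as multiplicities, of total 3 + 6 * 32 = 195. *)
Definition example_weight : seq nat :=
  [:: 0; 1; 2] ++ placed_K4 0 ++ placed_K4 0 ++ placed_K4 1 ++ placed_K4 1 ++
  placed_K4 2 ++ placed_K4 2.

Lemma count_example (A : {set example}) : balanced A ->
  count (mem_val A) example_weight <= 97.
Proof.
move=> bA; set a := mem_val A.
have copy k : k < 3 ->
    count a (placed_K4 k) + (a (place k 0) && a (place k 1)) <= 16.
  move=> k3; rewrite count_map.
  apply: (@count_gadget (preim (place k) a)).
  apply/allP => c cN; rewrite -all_map.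
  apply: (balanced_negative_cycle bA).
  exact: (allP (place_negative_cycles k3)).
have := copy 0 isT; have := copy 1 isT; have := copy 2 isT.
rewrite /example_weight 6!count_cat.
move: (count a (placed_K4 0)) (count a (placed_K4 1)) (count a (placed_K4 2)).
move=> x y z; rewrite [count a [:: 0; 1; 2]]/= /place /=.
(* With 0, 1, 2 or 3 corners chosen, 0, 0, 1 or 3 copies lose a unit, so the weight is at most 96,
   97, 96 or 93. *)
by case: (a 0); case: (a 1); case: (a 2) => /=; lia.
Qed.

End Example.

(** * Explicit coordinates for the drawing *)

Section Drawing.
Local Open Scope Z_scope.

(** All but the two corners lie inside the triangle (0, 0), (150, 0), (50, 50). Its apex is fixed by
    the rotation below, so the three copies do not overlap. *)
Definition gadget_points : seq (Z * Z) :=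
  [:: (0, 0); (150, 0); (50, 44); (53, 7); (72, 4); (64, 16); (100, 9);
      (94, 6); (89, 14); (118, 7); (129, 4); (79, 12); (61, 11); (65, 11);
      (69, 13); (104, 10); (63, 29); (85, 6); (61, 13); (65, 10); (73, 13);
      (95, 8); (88, 13); (117, 7)].

(* The affine map permuting (0, 0), (150, 0), (0, 150) cyclically. *)
Definition rotate_point (p : Z * Z) : Z * Z := (150 - p.1 - p.2, p.1).

(** The order follows the numbering of [place]. *)
Definition example_points : seq (Z * Z) :=
  [seq iter k rotate_point (0, 0) | k <- iota 0%N 3%N] ++
  flatten [seq [seq iter k rotate_point p | p <- drop 2%N gadget_points]
          | k <- iota 0%N 3%N].

Lemma example_planar (R : realType) : planar R example.
Proof. by apply: (@edge_graph_planar _ _ _ _ _ example_points); vm_compute. Qed.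

End Drawing.

Theorem theorem1 (R : realType) :
  exists G : signed_graph, planar R G /\ 2 < chi_fb R G.
Proof.
exists example; split; first exact: example_planar.
pose L : seq example := pmap insub example_weight.
have sizeL : size L = 195%N.
  by rewrite size_pmap (eq_count (@isSome_insub _ _ 'I_69)); vm_compute.
(* The ratio exceeds 2 since 2 * 97 = 194. *)
apply: (@lt_le_trans _ _ (195%:R / 97%:R)).
  by rewrite ltr_pdivlMr ?ltr0n // -natrM ltr_nat.
rewrite -sizeL; apply: chi_fb_ge => [|A bA]; first by rewrite sizeL.
by rewrite count_mem_val; exact: count_example.
Qed.
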